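(* Let $\mathbb F$ be any field. Let $H$ be a twin-free $\mathbb F$-weighted graph (directed or undirected). Then for every $k \ge 0$ and $n \ge 2$, $\mathcal G'[k] \cong \mathbb F^{r_k}$ as algebras, where \[ r_k = \dim \mathcal G'[k] = \operatorname{rk_S} T(k, n, H) = \operatorname{rank} T(k, n, H) = \operatorname{rank} M(k, H) \le \operatorname{rank} N(k, H) \le \operatorname{orb}_k(H). \]
   Context: An $\mathbb F$-weighted graph $H$ consists of a finite vertex set $V(H)$, vertex weights $\alpha_H(i)\in\mathbb F\setminus\{0\}$ and edge weights $\beta_H(i,j)\in\mathbb F$ for all ordered pairs $(i,j)$ (symmetric if undirected). $H$ is twin-free if there are no distinct $i,j$ with $\beta_H(i,\ell)=\beta_H(j,\ell)$ and $\beta_H(\ell,i)=\beta_H(\ell,j)$ for all $\ell$. $\operatorname{Aut}(H)$ is the group of bijections of $V(H)$ preserving all vertex and edge weights; it acts on $V(H)^k=\{\varphi\colon[k]\to V(H)\}$ by $\varphi\mapsto\sigma\circ\varphi$, and $\operatorname{orb}_k(H)$ is the number of orbits. A $k$-labeled graph is a finite graph (directed iff $H$ is), without loops but possibly with multiple edges, with $k$ distinct nodes labeled $1,\dots,k$; $\mathcal{PLG}[k]$ is the set of their isomorphism classes (label-preserving), and $U_k$ is the graph with $k$ labeled nodes and no edges. The product $G_1G_2$ of $k$-labeled graphs is their disjoint union with equally labeled nodes identified. $\mathcal G[k]$ is the $\mathbb F$-algebra with basis $\mathcal{PLG}[k]$ and this product (identity $U_k$). For $\varphi\colon[k]\to V(H)$,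 $\hom_\varphi(G,H)=\sum_{\phi}\prod_{u\text{ unlabeled}}\alpha_H(\phi(u))\prod_{uv\in E(G)}\beta_H(\phi(u),\phi(v))$ over $\phi\colon V(G)\to V(H)$ mapping the node labeled $i$ to $\varphi(i)$ (edges with multiplicity; directed edge $u\to v$ gives $\beta_H(\phi(u),\phi(v))$; $0^0=1$). $f_H(G)=\hom(G,H)=\sum_{\phi\colon V(G)\to V(H)}\prod_{u\in V(G)}\alpha_H(\phi(u))\prod_{uv\in E(G)}\beta_H(\phi(u),\phi(v))$ (labels ignored), extended linearly to $\mathcal G[k]$. $\mathcal K_{[k]}=\{x\in\mathcal G[k]: f_H(xy)=0\ \forall y\in\mathcal G[k]\}$ is an ideal and $\mathcal G'[k]=\mathcal G[k]/\mathcal K_{[k]}$; $\mathbb F^{r}$ carries componentwise multiplication. The connection tensor $T(k,n,H)$ is the function $\mathcal{PLG}[k]^n\to\mathbb F$, $(G_1,\dots,G_n)\mapsto f_H(G_1\cdots G_n)$, and $M(k,H)=T(k,2,H)$. Its rank is the least $r$ such that $T(G_1,\dots,G_n)=\sum_{i=1}^r a_i\prod_{j=1}^n \mathbf f_{ij}(G_j)$ for all arguments, for some $a_i\in\mathbb F$ and functions $\mathbf f_{ij}\colon\mathcal{PLG}[k]\to\mathbb F$ ($\infty$ if none); its symmetric rank $\operatorname{rk_S}$ is the least $r$ with $T(G_1,\dots,G_n)=\sum_{i=1}^r\lambda_i\prod_{j=1}^n\mathbf f_i(G_j)$. $N(k,H)$ is the matrix with rows indexed by $\varphi\in V(H)^k$,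 columns indexed by $\mathcal{PLG}[k]$ and $(\varphi,G)$-entry $\hom_\varphi(G,H)$. Matrix rank of a possibly infinite matrix is the dimension of its row space. *)

(* Defs.v *)
From HB Require Import structures.
From mathcomp Require Import all_boot all_fingroup all_algebra.
From mathcomp Require Import finmap.
From mathcomp Require Import generic_quotient ring_quotient.
From mathcomp Require Import boolp.
From mathcomp.multinomials Require Import monalg.

Set Implicit Arguments.
Unset Strict Implicit.
Unset Printing Implicit Defensive.

Import GRing.Theory.
Local Open Scope quotient_scope.
Local Open Scope ring_scope.

(* The flag [dir] says whether the graphs are directed. *)
Record wgraph (F : fieldType) (dir : bool) := WGraph {
  wvert : finType;
  walpha : wvert -> F;
  wbeta : wvert -> wvert -> F;
  walpha_neq0 : forall i, walpha i != 0;
  wbeta_sym : ~~ dir -> forall i j, wbeta i j = wbeta j i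
}.

Definition twin_free (F : fieldType) (dir : bool) (H : wgraph F dir) : Prop :=
  ~ exists i j : wvert H, i != j /\
      forall l, wbeta i l = wbeta j l /\ wbeta l i = wbeta l j.

Section Automorphisms.
Variables (F : fieldType) (dir : bool) (H : wgraph F dir).

Definition waut : {set {perm wvert H}} :=
  [set s : {perm wvert H} | [forall i, walpha (s i) == walpha i]
           && [forall i, forall j, wbeta (s i) (s j) == wbeta i j]].

Lemma wautP (s : {perm wvert H}) :
  reflect ((forall i, walpha (s i) = walpha i) /\
           (forall i j, wbeta (s i) (s j) = wbeta i j)) (s \in waut).
Proof.
rewrite inE; apply: (iffP andP) => -[sa sb]; split.
- by move=> i; apply/eqP/(forallP sa).
- by move=> i j; apply/eqP; move/forallP/(_ i)/forallP: sb; apply.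
- by apply/forallP => i; rewrite sa.
- by apply/forallP => i; apply/forallP => j; rewrite sb.
Qed.

Lemma waut_group_set : group_set waut.
Proof.
apply/group_setP; split; first by apply/wautP; split=> *; rewrite !perm1.
move=> s t /wautP[sa sb] /wautP[ta tb]; apply/wautP.
by split=> *; rewrite !permM ?ta ?tb.
Qed.
Canonical waut_group := Group waut_group_set.

Variable k : nat.

Definition map_act (phi : {ffun 'I_k -> wvert H}) (s : {perm wvert H}) :
  {ffun 'I_k -> wvert H} := [ffun i => s (phi i)].

Lemma map_act1 phi : map_act phi 1%g = phi.
Proof. by apply/ffunP => i; rewrite ffunE perm1. Qed.

Lemma map_actM phi : act_morph map_act phi.
Proof. by move=> s t; apply/ffunP => i; rewrite !ffunE permM. Qed.

Definition map_action := TotalAction map_act1 map_actM.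

Definition orb_num : nat :=
  #|orbit map_action waut @: [set: {ffun 'I_k -> wvert H}]|.

End Automorphisms.

(* [inl i] is the node labeled [i], the nodes [inr j] are unlabeled. *)
Definition lvert (k m : nat) : Type := ('I_k + 'I_m)%type.
HB.instance Definition _ k m := Finite.on (lvert k m).

(* The edges form a list in which the order of the edges, and in the          *)
(* undirected case also the orientation of each edge, is irrelevant; these    *)
(* are forgotten by [lg_iso] below.                                           *)
Definition lgraph (k : nat) : Type :=
  {m : nat & {E : seq (lvert k m * lvert k m) | all (fun e => e.1 != e.2) E}}.
HB.instance Definition _ k := Choice.on (lgraph k).

Section LabeledGraphs.
Variables (dir : bool) (k : nat).
Implicit Types G : lgraph k.

Definition lg_size G : nat := tag G.
Definition lg_edges G : seq (lvert k (lg_size G) * lvert k (lg_size G)) :=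
  sval (tagged G).

Lemma lg_loopless G : all (fun e => e.1 != e.2) (lg_edges G).
Proof. exact: (svalP (tagged G)). Qed.

Definition LGraph m (E : seq (lvert k m * lvert k m))
    (EP : all (fun e => e.1 != e.2) E) : lgraph k :=
  Tagged (fun m => {E : seq (lvert k m * lvert k m)
                   | all (fun e => e.1 != e.2) E}) (exist _ E EP).

Definition mapp (S T : Type) (f : S -> T) (e : S * S) : T * T := (f e.1, f e.2).

(* In the undirected case every edge contributes its two orientations, so     *)
(* that the multiplicity of (u, v) in [arcs] is the number of edges from u to *)
(* v, resp. between u and v.                                                  *)
Definition arcs (T : Type) (E : seq (T * T)) : seq (T * T) :=
  if dir then E else E ++ [seq (e.2, e.1) | e <- E].

Definition lg_iso_prop G1 G2 : Prop :=
  exists s : lvert k (lg_size G1) -> lvert k (lg_size G2),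
    [/\ bijective s, forall i, s (inl i) = inl i
      & perm_eq (map (mapp s) (arcs (lg_edges G1))) (arcs (lg_edges G2))].

Definition lg_iso : rel (lgraph k) := fun G1 G2 => `[< lg_iso_prop G1 G2 >].

Lemma arcs_dir (T : Type) (E : seq (T * T)) : dir -> arcs E = E.
Proof. by rewrite /arcs => ->. Qed.

Lemma arcs_undir (T : Type) (E : seq (T * T)) :
  ~~ dir -> arcs E = E ++ [seq (e.2, e.1) | e <- E].
Proof. by rewrite /arcs => /negbTE->. Qed.

Lemma arcs_map (S T : Type) (f : S -> T) E :
  arcs (map (mapp f) E) = map (mapp f) (arcs E).
Proof. by rewrite /arcs; case: dir => //; rewrite map_cat -!map_comp. Qed.

Lemma arcs_cat (T : eqType) (E1 E2 : seq (T * T)) :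
  perm_eq (arcs (E1 ++ E2)) (arcs E1 ++ arcs E2).
Proof.
rewrite /arcs; case: dir => //; rewrite map_cat -!catA perm_cat2l.
by rewrite perm_catCA.
Qed.

Lemma perm_arcs (T : eqType) (E1 E2 : seq (T * T)) :
  perm_eq E1 E2 -> perm_eq (arcs E1) (arcs E2).
Proof. by rewrite /arcs; case: dir => // h; apply: perm_cat => //; apply: perm_map. Qed.

Lemma size_arcs_eq0 (T : Type) (E : seq (T * T)) : size (arcs E) = 0%N -> E = [::].
Proof. by rewrite /arcs; case: dir => /=; case: E. Qed.

Lemma mapp_id (T : Type) : @mapp T T id =1 id.
Proof. by case. Qed.

Lemma mapp_comp (S T U : Type) (f : T -> U) (g : S -> T) E :
  map (mapp f) (map (mapp g) E) = map (mapp (f \o g)) E.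
Proof. by rewrite -map_comp; apply: eq_map. Qed.

Lemma lg_iso_refl : reflexive lg_iso.
Proof.
move=> G; apply/asboolP; exists id; split=> //; first by exists id.
by rewrite (eq_map (@mapp_id _)) map_id.
Qed.

Lemma lg_iso_prop_sym G1 G2 : lg_iso_prop G1 G2 -> lg_iso_prop G2 G1.
Proof.
case=> s [[t sK tK] sl sE]; exists t; split; first by exists s.
  by move=> i; rewrite -[inl i in LHS]sl sK.
rewrite perm_sym; have := perm_map (mapp t) sE.
by rewrite mapp_comp (eq_map (g := id)) ?map_id // => -[u v]; rewrite /mapp /= !sK.
Qed.

Lemma lg_iso_sym : symmetric lg_iso.
Proof. by move=> G1 G2; apply/asboolP/asboolP; apply: lg_iso_prop_sym. Qed.

Lemma lg_iso_trans : transitive lg_iso.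
Proof.
move=> G2 G1 G3 /asboolP[s [sb sl sE]] /asboolP[t [tb tl tE]].
apply/asboolP; exists (t \o s); split; first exact: bij_comp.
  by move=> i /=; rewrite sl tl.
by apply: perm_trans tE; rewrite -mapp_comp; apply: perm_map.
Qed.

Canonical lg_iso_equiv := EquivRel lg_iso lg_iso_refl lg_iso_sym lg_iso_trans.

Definition PLG : Type := {eq_quot lg_iso}.
HB.instance Definition _ : EqQuotient (lgraph k) lg_iso PLG := EqQuotient.on PLG.
HB.instance Definition _ := Choice.on PLG.

Lemma PLG_eqP G1 G2 : \pi_PLG G1 = \pi_PLG G2 <-> lg_iso_prop G1 G2.
Proof.
split; first by move/eqP; rewrite piE => /asboolP.
by move=> h; apply/eqP; rewrite piE; apply/asboolP.
Qed.

Definition glue_l m1 m2 (v : lvert k m1) : lvert k (m1 + m2) :=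
  match v with inl i => inl i | inr j => inr (lshift m2 j) end.
Definition glue_r m1 m2 (v : lvert k m2) : lvert k (m1 + m2) :=
  match v with inl i => inl i | inr j => inr (rshift m1 j) end.

Lemma glue_l_inj m1 m2 : injective (@glue_l m1 m2).
Proof.
by move=> [i|i] [j|j] // []; [move->|move/val_inj->].
Qed.

Lemma glue_r_inj m1 m2 : injective (@glue_r m1 m2).
Proof.
by move=> [i|i] [j|j] // []; [move->|move/addnI/val_inj->].
Qed.

Definition glue_edges m1 m2 (E1 : seq (lvert k m1 * lvert k m1))
    (E2 : seq (lvert k m2 * lvert k m2)) :=
  map (mapp (@glue_l m1 m2)) E1 ++ map (mapp (@glue_r m1 m2)) E2.

Lemma glue_loopless G1 G2 :
  all (fun e => e.1 != e.2) (glue_edges (lg_edges G1) (lg_edges G2)).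
Proof.
rewrite all_cat !all_map; apply/andP; split.
  by apply: sub_all (lg_loopless G1) => e; rewrite /= (inj_eq (@glue_l_inj _ _)).
by apply: sub_all (lg_loopless G2) => e; rewrite /= (inj_eq (@glue_r_inj _ _)).
Qed.

Definition lg_glue G1 G2 : lgraph k := LGraph (glue_loopless G1 G2).

Lemma lg_glueE G1 G2 :
  lg_edges (lg_glue G1 G2) = glue_edges (lg_edges G1) (lg_edges G2).
Proof. by []. Qed.

Definition lg_unit : lgraph k := @LGraph 0 [::] isT.

Lemma lg_iso_glue G1 G2 G1' G2' : lg_iso_prop G1 G1' -> lg_iso_prop G2 G2' ->
  lg_iso_prop (lg_glue G1 G2) (lg_glue G1' G2').
Proof.
move=> [s [[s' sK s'K] sl sE]] [t [[t' tK t'K] tl tE]].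
have s'l i : s' (inl i) = inl i by rewrite -[inl i in LHS]sl sK.
have t'l i : t' (inl i) = inl i by rewrite -[inl i in LHS]tl tK.
pose f m1 m2 m1' m2' (a : lvert k m1 -> lvert k m1')
    (b : lvert k m2 -> lvert k m2') (v : lvert k (m1 + m2)) :=
  match v with
  | inl i => inl i
  | inr j => match split j with
             | inl x => @glue_l m1' m2' (a (inr x))
             | inr y => @glue_r m1' m2' (b (inr y)) end
  end.
have fl m1 m2 m1' m2' a b : (forall i, a (inl i) = inl i) ->
    forall v, @f m1 m2 m1' m2' a b (glue_l m2 v) = glue_l m2' (a v).
  by move=> al [i|j] /=; rewrite ?al // (unsplitK (inl j)).
have fr m1 m2 m1' m2' a b : (forall i, b (inl i) = inl i) ->
    forall v, @f m1 m2 m1' m2' a b (glue_r m1 v) = glue_r m1' (b v).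
  by move=> al [i|j] /=; rewrite ?al // (unsplitK (inr j)).
have fK m1 m2 m1' m2' a b a' b' : cancel a a' -> cancel b b' ->
    (forall i, a' (inl i) = inl i) -> (forall i, b' (inl i) = inl i) ->
    cancel (@f m1 m2 m1' m2' a b) (f _ _ _ _ a' b').
  move=> aK bK al bl [i|j] //=; rewrite -{2}(splitK j).
  by case: (split j) => x /=; rewrite ?fl ?fr ?aK ?bK.
exists (f _ _ _ _ s t); split => //.
  by exists (f _ _ _ _ s' t'); apply: fK.
rewrite -arcs_map /= /glue_edges map_cat !mapp_comp.
rewrite (eq_map (g := mapp (@glue_l _ _ \o s))); last first.
  by move=> e; rewrite /mapp /= !fl.
rewrite [X in _ ++ X](eq_map (g := mapp (@glue_r _ _ \o t))); last first.
  by move=> e; rewrite /mapp /= !fr.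
apply: perm_trans (arcs_cat _ _) _.
rewrite perm_sym; apply: perm_trans (arcs_cat _ _) _; rewrite perm_sym.
by rewrite -(mapp_comp _ s) -(mapp_comp _ t) !arcs_map; apply: perm_cat; apply: perm_map.
Qed.

Definition PLG_mul (x y : PLG) : PLG := \pi_PLG (lg_glue (repr x) (repr y)).
Definition PLG_one : PLG := \pi_PLG lg_unit.

Lemma pi_glue G1 G2 : PLG_mul (\pi_PLG G1) (\pi_PLG G2) = \pi_PLG (lg_glue G1 G2).
Proof.
by apply/PLG_eqP/lg_iso_glue; apply/PLG_eqP; rewrite reprK.
Qed.

Lemma lg_iso_eq G1 G2 (f : lvert k (lg_size G1) -> lvert k (lg_size G2)) :
  bijective f -> (forall i, f (inl i) = inl i) ->
  perm_eq (map (mapp f) (lg_edges G1)) (lg_edges G2) -> lg_iso_prop G1 G2.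
Proof.
by move=> fb fl fE; exists f; split; rewrite // -arcs_map; apply: perm_arcs.
Qed.

Definition lcast m m' (e : m = m') (v : lvert k m) : lvert k m' :=
  match v with inl i => inl i | inr j => inr (cast_ord e j) end.

Lemma lcast_bij m m' (e : m = m') : bijective (lcast e).
Proof.
by exists (lcast (esym e)); case=> i //=; rewrite ?cast_ordK ?cast_ordKV.
Qed.

Lemma PLG_mulA : associative PLG_mul.
Proof.
move=> x y z; rewrite -[x]reprK -[y]reprK -[z]reprK.
move: (repr x) (repr y) (repr z) => G1 G2 G3.
rewrite (pi_glue G2 G3) (pi_glue G1 G2) pi_glue [RHS]pi_glue; apply/PLG_eqP.
apply: (@lg_iso_eq (lg_glue G1 (lg_glue G2 G3)) (lg_glue (lg_glue G1 G2) G3)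
  (lcast (addnA (lg_size G1) (lg_size G2) (lg_size G3)))) => //.
  exact: lcast_bij.
rewrite /= /glue_edges !map_cat !mapp_comp catA.
have eq_perm (T : eqType) (a b : seq T) : a = b -> perm_eq a b by move=> ->.
apply: eq_perm; rewrite !lg_glueE /glue_edges map_cat !mapp_comp.
congr (_ ++ _); first congr (_ ++ _);
  by apply: eq_map => -[[i|i] [j|j]]; congr (_, _) => //=; congr inr;
     apply: val_inj => /=; rewrite ?addnA.
Qed.

Lemma PLG_mulC : commutative PLG_mul.
Proof.
move=> x y; rewrite -[x]reprK -[y]reprK !pi_glue; apply/PLG_eqP.
set G1 := repr x; set G2 := repr y.
pose sw m1 m2 (v : lvert k (m1 + m2)) : lvert k (m2 + m1) :=
  match v with
  | inl i => inl i
  | inr j => match split j with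
             | inl x => inr (rshift m2 x) | inr y => inr (lshift m1 y) end
  end.
have swl m1 m2 v : @sw m1 m2 (glue_l m2 v) = glue_r m2 v.
  by case: v => //= j; rewrite (unsplitK (inl j)).
have swr m1 m2 v : @sw m1 m2 (glue_r m1 v) = glue_l m1 v.
  by case: v => //= j; rewrite (unsplitK (inr j)).
have swK m1 m2 : cancel (@sw m1 m2) (@sw m2 m1).
  case=> // j /=; rewrite -{2}(splitK j); case: (split j) => x' /=.
    by rewrite (unsplitK (inr x')).
  by rewrite (unsplitK (inl x')).
apply: (@lg_iso_eq (lg_glue G1 G2) (lg_glue G2 G1) (@sw _ _)) => //; first by exists (@sw _ _); apply: swK.
rewrite /= /glue_edges map_cat !mapp_comp perm_catC.
rewrite (eq_map (g := mapp (@glue_l _ _))); last by move=> e; rewrite /mapp /= !swr.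
by rewrite [X in _ ++ X](eq_map (g := mapp (@glue_r _ _))) // => e; rewrite /mapp /= !swl.
Qed.

Lemma PLG_mul1 : left_id PLG_one PLG_mul.
Proof.
move=> x; rewrite -[x]reprK pi_glue; apply/PLG_eqP.
set G := repr x.
apply: (@lg_iso_eq (lg_glue lg_unit G) G (lcast (add0n (lg_size G)))) => //.
  exact: lcast_bij.
rewrite /= /glue_edges /= mapp_comp (eq_map (g := id)) ?map_id //.
by move=> -[[i|i] [j|j]]; congr (_, _) => //=; congr inr; apply: val_inj.
Qed.

Lemma PLG_mulr1 : right_id PLG_one PLG_mul.
Proof. by move=> x; rewrite PLG_mulC PLG_mul1. Qed.

Lemma lg_iso_unit G : lg_iso_prop G lg_unit <-> lg_size G = 0%N /\ lg_edges G = [::].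
Proof.
split.
  case=> s [sb _ /perm_size]; rewrite size_map {2}/arcs /=.
  have -> : size (if dir then [::] else [::]) = 0%N :> nat by case: dir.
  move/size_arcs_eq0 => ->; split=> //.
  by have := bij_eq_card sb; rewrite !card_sum !card_ord /= => /addnI.
case: G => m [E EP]; rewrite /lg_size /lg_edges /= => -[m0 E0].
subst m; rewrite E0 in EP *; apply: (@lg_iso_eq _ lg_unit id) => //.
by exists id.
Qed.

Lemma PLG_unit x y : PLG_mul x y = PLG_one -> x = PLG_one /\ y = PLG_one.
Proof.
rewrite -[x]reprK -[y]reprK pi_glue => /PLG_eqP/lg_iso_unit [/= m0 E0].
move: (repr x) (repr y) m0 E0 => G1 G2 /eqP; rewrite addn_eq0 => /andP[/eqP m1 /eqP m2].
move/(congr1 size)/eqP; rewrite size_cat !size_map addn_eq0 => /andP[].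
by move=> /eqP/size0nil E1 /eqP/size0nil E2; split; apply/PLG_eqP/lg_iso_unit.
Qed.

HB.instance Definition _ := Choice_isMonomialDef.Build PLG
  PLG_mulA PLG_mul1 PLG_mulr1 PLG_unit.
HB.instance Definition _ := MonomialDef_isConomialDef.Build PLG PLG_mulC.

End LabeledGraphs.

Section Homomorphisms.
Variables (F : fieldType) (dir : bool) (H : wgraph F dir) (k : nat).

Definition lg_hom (phi : {ffun 'I_k -> wvert H}) (G : lgraph k) : F :=
  \sum_(psi : {ffun lvert k (lg_size G) -> wvert H}
        | [forall i, psi (inl i) == phi i])
    (\prod_(j < lg_size G) walpha (psi (inr j))) *
    \prod_(e <- lg_edges G) wbeta (psi e.1) (psi e.2).

Definition lg_homT (G : lgraph k) : F :=
  \sum_(psi : {ffun lvert k (lg_size G) -> wvert H})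
    (\prod_v walpha (psi v)) * \prod_(e <- lg_edges G) wbeta (psi e.1) (psi e.2).

Lemma wbeta_prod_arcs (T : finType) (psi : T -> wvert H) (E1 E2 : seq (T * T)) :
  perm_eq (arcs dir E1) (arcs dir E2) ->
  \prod_(e <- E1) wbeta (psi e.1) (psi e.2)
  = \prod_(e <- E2) wbeta (psi e.1) (psi e.2).
Proof.
have [dirT|ndir] : dir \/ ~~ dir by apply/orP; rewrite orbN.
  by rewrite !arcs_dir //; apply: perm_big.
pose nrm (e : T * T) :=
  if (enum_rank e.1 <= enum_rank e.2)%N then e else (e.2, e.1).
have nrm_sw e : nrm (e.2, e.1) = nrm e.
  by case: e => u v; rewrite /nrm /=; case: ltngtP => // /val_inj/enum_rank_inj->.
have bnrm (E : seq (T * T)) : \prod_(e <- E) wbeta (psi e.1) (psi e.2)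
    = \prod_(e <- map nrm E) wbeta (psi e.1) (psi e.2).
  rewrite big_map; apply: eq_bigr => e _; rewrite /nrm.
  by case: ifP => //= _; apply: wbeta_sym.
rewrite !arcs_undir // => /(perm_map nrm).
rewrite !map_cat -!map_comp !(eq_map (f := nrm \o _) nrm_sw) => /seq.permP h.
rewrite (bnrm E1) (bnrm E2); apply: perm_big; apply/seq.permP => p; have := h p.
by rewrite !count_cat !addnn => /double_inj.
Qed.

Lemma prod_unlabeled m (g : lvert k m -> F) :
  \prod_(j < m) g (inr j) = \prod_(v | ~~ is_inl v) g v.
Proof. by rewrite big_sumType /= big_pred0_eq mul1r. Qed.

(* [lg_hom] and [lg_homT] are invariant under isomorphism, so that the        *)
(* functions on [PLG] defined below through [repr] do not depend on the       *)
(* chosen representatives.                                                    *)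
Lemma lg_hom_iso phi G1 G2 :
  lg_iso_prop dir G1 G2 -> lg_hom phi G1 = lg_hom phi G2.
Proof.
case=> s [sb sl sE]; have [t sK tK] := sb.
have tl i : t (inl i) = inl i by rewrite -[inl i in LHS]sl sK.
rewrite /lg_hom.
rewrite (reindex (fun psi : {ffun _ -> wvert H} => [ffun v => psi (s v)])); last first.
  exists (fun psi : {ffun _ -> wvert H} => [ffun v => psi (t v)]) => psi _;
    by apply/ffunP => v; rewrite !ffunE ?sK ?tK.
apply: eq_big => [psi|psi _].
  by apply: eq_forallb => i; rewrite ffunE sl.
congr (_ * _).
  rewrite (prod_unlabeled (fun v => walpha (psi v))) (reindex s) /=; last first.
    by apply: onW_bij.
  rewrite (prod_unlabeled (fun v => walpha ([ffun v => psi (s v)] v))).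
  apply: eq_big => [v|v _]; last by rewrite ffunE.
  case: v => [i|j]; first by rewrite sl.
  case E: (s (inr j)) => [i|//]; move: (congr1 t E).
  by rewrite sK tl.
rewrite -arcs_map in sE; rewrite -(wbeta_prod_arcs psi sE) big_map.
by apply: eq_bigr => e _; rewrite !ffunE.
Qed.

Lemma lg_homT_iso G1 G2 : lg_iso_prop dir G1 G2 -> lg_homT G1 = lg_homT G2.
Proof.
case=> s [sb sl sE]; have [t sK tK] := sb.
rewrite /lg_homT.
rewrite (reindex (fun psi : {ffun _ -> wvert H} => [ffun v => psi (s v)])); last first.
  exists (fun psi : {ffun _ -> wvert H} => [ffun v => psi (t v)]) => psi _;
    by apply/ffunP => v; rewrite !ffunE ?sK ?tK.
apply: eq_bigr => psi _; congr (_ * _).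
  rewrite [RHS](reindex s) /=; last by apply: onW_bij.
  by apply: eq_bigr => v _; rewrite ffunE.
rewrite -arcs_map in sE; rewrite -(wbeta_prod_arcs psi sE) big_map.
by apply: eq_bigr => e _; rewrite !ffunE.
Qed.

Definition hom_phi (phi : {ffun 'I_k -> wvert H}) (G : PLG dir k) : F :=
  lg_hom phi (repr G).

Definition hom (G : PLG dir k) : F := lg_homT (repr G).

Lemma hom_phi_pi phi G : hom_phi phi (\pi_(PLG dir k) G) = lg_hom phi G.
Proof. by apply: lg_hom_iso; apply/PLG_eqP; rewrite reprK. Qed.

Lemma hom_pi G : hom (\pi_(PLG dir k) G) = lg_homT G.
Proof. by apply: lg_homT_iso; apply/PLG_eqP; rewrite reprK. Qed.

Definition homL : {malg F[PLG dir k]} -> F := mmap idfun hom.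

Definition homK : {pred {malg F[PLG dir k]}} :=
  [pred x | `[< forall y : {malg F[PLG dir k]}, homL (x * y) = 0 >]].

Lemma homKP x : reflect (forall y, homL (x * y) = 0) (x \in homK).
Proof. exact: asboolP. Qed.

Lemma homLZ a x : homL (a *: x) = a * homL x.
Proof.
rewrite /homL (mmapEw (msuppZ_le _ _)) mmapE big_distrr /=.
by apply: eq_bigr => G _; rewrite mcoeffZ mulrA.
Qed.

Lemma homK_zmod : zmod_closed homK.
Proof.
split; first by apply/homKP => y; rewrite mul0r /homL raddf0.
move=> u v /homKP hu /homKP hv; apply/homKP => y.
by rewrite mulrBl /homL raddfB [X in X - _]hu [X in _ - X]hv subr0.
Qed.
HB.instance Definition _ := GRing.isZmodClosed.Build _ homK homK_zmod.

Lemma homKM x y : x \in homK -> x * y \in homK.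
Proof. by move/homKP => hx; apply/homKP => z; rewrite -mulrA. Qed.

Lemma homKZ a x : x \in homK -> a *: x \in homK.
Proof.
by move/homKP => hx; apply/homKP => z; rewrite -scalerAl homLZ hx mulr0.
Qed.

(* The library only has quotient rings by proper ideals, whereas [homK] may   *)
(* be the unit ideal; the algebra structure on the quotient is built here     *)
(* without assuming 1 != 0.                                                   *)
Definition qalg : Type := Quotient.quot homK.
HB.instance Definition _ := GRing.Zmodule.on qalg.
HB.instance Definition _ : EqQuotient _ (Quotient.equiv homK) qalg :=
  EqQuotient.on qalg.

Definition qone : qalg := \pi_qalg 1.
Definition qmul (x y : qalg) : qalg := \pi_qalg (repr x * repr y).
Definition qscale (a : F) (x : qalg) : qalg := \pi_qalg (a *: repr x).

Lemma qalg_eqP x y : \pi_qalg x = \pi_qalg y <-> x - y \in homK.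
Proof. by rewrite Quotient.idealrBE; split=> /eqP. Qed.

Lemma qpiD x y : \pi_qalg (x + y) = \pi_qalg x + \pi_qalg y.
Proof. by rewrite !piE. Qed.

Lemma qrepr x : repr (\pi_qalg x) - x \in homK.
Proof. by apply/qalg_eqP; rewrite reprK. Qed.

Lemma qpiM x y : qmul (\pi_qalg x) (\pi_qalg y) = \pi_qalg (x * y).
Proof.
apply/qalg_eqP.
set x' := repr _; set y' := repr _.
have -> : x' * y' - x * y = (x' - x) * y' + (y' - y) * x.
  by rewrite !mulrBl addrA [y' * x]mulrC subrK [y * x]mulrC.
by rewrite rpredD ?homKM ?qrepr.
Qed.

Lemma qpiZ a x : qscale a (\pi_qalg x) = \pi_qalg (a *: x).
Proof. by apply/qalg_eqP; rewrite -scalerBr homKZ ?qrepr. Qed.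

Lemma qmulA : associative qmul.
Proof.
move=> x y z; rewrite -[x]reprK -[y]reprK -[z]reprK.
move: (repr x) (repr y) (repr z) => a b c.
by rewrite (qpiM b c) (qpiM a b) qpiM [RHS]qpiM mulrA.
Qed.

Lemma qmulC : commutative qmul.
Proof.
by move=> x y; rewrite -[x]reprK -[y]reprK qpiM [RHS]qpiM mulrC.
Qed.

Lemma qmul1 : left_id qone qmul.
Proof. by move=> x; rewrite -[x]reprK qpiM mul1r. Qed.

Lemma qmulD : left_distributive qmul +%R.
Proof.
move=> x y z; rewrite -[x]reprK -[y]reprK -[z]reprK.
move: (repr x) (repr y) (repr z) => a b c.
by rewrite -qpiD (qpiM (a + b)) (qpiM a) (qpiM b) -qpiD mulrDl.
Qed.

HB.instance Definition _ :=
  GRing.Zmodule_isComPzRing.Build qalg qmulA qmulC qmul1 qmulD.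

Lemma qscaleA a b x : qscale a (qscale b x) = qscale (a * b) x.
Proof. by rewrite -[x]reprK (qpiZ b) (qpiZ a) (qpiZ (a * b)) scalerA. Qed.

Lemma qscale1 : left_id 1 qscale.
Proof. by move=> x; rewrite -[x]reprK qpiZ scale1r. Qed.

Lemma qscaleDr : right_distributive qscale +%R.
Proof.
move=> a x y; rewrite -[x]reprK -[y]reprK; move: (repr x) (repr y) => b c.
by rewrite -qpiD (qpiZ a (b + c)) (qpiZ a b) (qpiZ a c) -qpiD scalerDr.
Qed.

Lemma qscaleDl x : {morph qscale^~ x : a b / a + b}.
Proof. by move=> a b; rewrite -[x]reprK (qpiZ (a + b)) (qpiZ a) (qpiZ b) -qpiD scalerDl. Qed.

HB.instance Definition _ := GRing.Zmodule_isLmodule.Build F qalg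
  qscaleA qscale1 qscaleDr qscaleDl.

Lemma qscaleAl (a : F) (x y : qalg) : a *: (x * y) = (a *: x) * y.
Proof.
rewrite -[x]reprK -[y]reprK; move: (repr x) (repr y) => b c.
transitivity (\pi_qalg (a *: (b * c))).
  by rewrite -qpiZ -qpiM.
by rewrite scalerAl -qpiM -qpiZ.
Qed.

(* {ffun 'I_r -> F^o} is F^r with componentwise operations; the regular       *)
(* module F^o only serves to give it a scaling by F.                          *)
Definition qalg_iso (r : nat) : Prop :=
  exists f : qalg -> {ffun 'I_r -> F^o},
    [/\ bijective f, linear f & GRing.monoid_morphism f].

Definition conn_tensor (n : nat) (t : n.-tuple (PLG dir k)) : F :=
  hom (\big[mmul/mone]_(G <- t) G).

Definition conn_matrix (G1 G2 : PLG dir k) : F := conn_tensor [tuple G1; G2].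

Definition hom_matrix (phi : {ffun 'I_k -> wvert H}) (G : PLG dir k) : F :=
  hom_phi phi G.

End Homomorphisms.

Arguments hom {F dir} H {k} G.
Arguments conn_tensor {F dir} H k n t.
Arguments conn_matrix {F dir} H k G1 G2.
Arguments hom_matrix {F dir} H k phi G.

Section Ranks.
Variable F : fieldType.

Definition is_dim (V : lmodType F) (r : nat) : Prop :=
  exists e : 'I_r -> V,
    (forall v, exists c : 'I_r -> F, v = \sum_i c i *: e i) /\
    (forall c : 'I_r -> F, \sum_i c i *: e i = 0 -> forall i, c i = 0).

Definition row_space (I J : Type) (A : I -> J -> F) (v : J -> F) : Prop :=
  exists s : seq (F * I), forall j, v j = \sum_(p <- s) p.1 * A p.2 j.

Definition is_mxrank (I J : Type) (A : I -> J -> F) (r : nat) : Prop :=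
  exists e : 'I_r -> J -> F,
    [/\ forall i, row_space A (e i),
        forall v, row_space A v ->
          exists c : 'I_r -> F, forall j, v j = \sum_i c i * e i j
      & forall c : 'I_r -> F,
          (forall j, \sum_i c i * e i j = 0) -> forall i, c i = 0].

Definition is_least (P : nat -> Prop) (r : nat) : Prop :=
  P r /\ forall s, P s -> (r <= s)%N.

Definition is_tensor_rank (X : Type) (n : nat) (T : n.-tuple X -> F) :
    nat -> Prop :=
  is_least (fun r => exists (a : 'I_r -> F) (f : 'I_r -> 'I_n -> X -> F),
    forall t, T t = \sum_i a i * \prod_j f i j (tnth t j)).

Definition is_sym_rank (X : Type) (n : nat) (T : n.-tuple X -> F) :
    nat -> Prop :=
  is_least (fun r => exists (a : 'I_r -> F) (f : 'I_r -> X -> F),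
    forall t, T t = \sum_i a i * \prod_j f i (tnth t j)).

End Ranks.

(* Main.v *)
(* Each map phi : [k] -> V(H) gives a multiplicative function hom_phi on the   *)
(* monoid PLG[k], and f_H is a linear combination of these. Collect equal      *)
(* functions and let chi_1, ..., chi_r be the distinct ones whose total        *)
(* coefficient a_i is nonzero, so that f_H = sum_i a_i chi_i. Distinct          *)
(* characters have a dual family d_1, ..., d_r in the monoid algebra, i.e.     *)
(* chi_j(d_i) = [i = j]. Hence K_[k] is the common kernel of the chi_i and     *)
(* G'[k] is F^r through (chi_1, ..., chi_r); the expansion                     *)
(* T(G_1, ..., G_n) = sum_i a_i chi_i(G_1) ... chi_i(G_n) has length r, and no *)
(* decomposition is shorter because M evaluated on the d_i is diag(a_i).       *)
(* The rank of N counts all the distinct hom_phi, and hom_phi only depends on  *)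
(* the orbit of phi.                                                           *)

From HB Require Import structures.
From mathcomp Require Import all_boot all_fingroup all_algebra.
From mathcomp Require Import finmap generic_quotient.
From mathcomp Require Import boolp.
From mathcomp.multinomials Require Import monalg.
Require Import Defs.

Set Implicit Arguments.
Unset Strict Implicit.
Unset Printing Implicit Defensive.

Import GRing.Theory.
Local Open Scope quotient_scope.
Local Open Scope ring_scope.

(** Everything rests on f_H being a combination, with nonzero coefficients, of finitely many
    distinct characters ([hom_phi_mmorphism], [hom_sum_supp]). Their dual family ([chi_dual])
    reduces the rest to linear algebra: it identifies the kernel ([homK_chi]), inverts the map to
    F^r ([qalg_isoP]) and bounds the ranks from below ([functional_factor_ge]). Independence of all
    distinct [hom_phi] gives the rank of N ([hom_matrix_rank]), and [hom_phi_aut] brings in the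
    orbits. *)

(** * Distinct characters of a commutative monoid *)

Section CharacterFamily.
Variables (F : fieldType) (X : conomType) (r : nat).
Variable chi : 'I_r -> {mmorphism X -> F}.
Hypothesis chi_inj : forall i j, chi i =1 chi j -> i = j.

(** [mmap idfun g] is the linear extension of [g] to the monoid algebra; here [g] need not be
    multiplicative. *)
Lemma mmap_sum (I : finType) (a : I -> F) (g : I -> X -> F) y :
  mmap idfun (fun x => \sum_i a i * g i x) y = \sum_i a i * mmap idfun (g i) y.
Proof.
rewrite mmapE; under eq_bigr do rewrite mulr_sumr.
rewrite exchange_big; apply: eq_bigr => i _; rewrite mmapE mulr_sumr.
by apply: eq_bigr => x _; rewrite mulrCA.
Qed.

Lemma chi_separate i j : i != j ->
  exists e, mmap idfun (chi i) e = 1 /\ mmap idfun (chi j) e = 0.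
Proof.
move=> ij; have [x xP] : exists x, chi i x != chi j x.
  apply: contrapT => h; move/eqP: ij; apply; apply: chi_inj => x.
  by apply/eqP/negPn/negP => xP; apply: h; exists x.
exists ((chi i x - chi j x)^-1 *: (<< x >> - chi j x *: 1)).
rewrite !mmapZ !raddfB /= !mmapZ !mmap1 !mmapU /= !mul1r !mulr1.
by rewrite mulVf ?subr_eq0 // subrr mulr0.
Qed.

(* Lagrange interpolation in the monoid algebra; it replaces the usual        *)
(* induction for Dedekind's independence of characters.                       *)
Lemma chi_dual : exists d : 'I_r -> {malg F[X]},
  forall i j, mmap idfun (chi j) (d i) = (i == j)%:R.
Proof.
have /choice[e eP] : forall p : 'I_r * 'I_r, exists e, p.1 != p.2 ->
    mmap idfun (chi p.1) e = 1 /\ mmap idfun (chi p.2) e = 0.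
  case=> i j /=.
  (* On the diagonal 0 is a dummy; the product below omits that factor. *)
  have [->|/chi_separate[e ?]] := eqVneq i j; first by exists 0.
  by exists e.
exists (fun i => \prod_(j | i != j) e (i, j)) => i j; rewrite rmorph_prod /=.
have [<-|ij] := eqVneq i j; first by apply: big1 => l il; have [] := eP (i, l) il.
by rewrite (bigD1 j) //= (eP (i, j) ij).2 mul0r.
Qed.

Lemma mmap_dual_sum (d : 'I_r -> {malg F[X]}) :
  (forall i j, mmap idfun (chi j) (d i) = (i == j)%:R) ->
  forall (v : 'I_r -> F) i, mmap idfun (chi i) (\sum_j v j *: d j) = v i.
Proof.
move=> dP v i; rewrite raddf_sum /= (bigD1 i) //= mmapZ dP eqxx mulr1.
by rewrite big1 ?addr0 // => j ji; rewrite mmapZ dP (negbTE ji) mulr0.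
Qed.

(** The characters span the row space, and evaluating a vanishing combination at the dual element
    [d i] isolates its i-th coefficient. *)
Lemma chi_mxrank (I : Type) (A : I -> X -> F) :
  (forall i, exists c : 'I_r -> F, forall x, A i x = \sum_j c j * chi j x) ->
  (forall j, row_space A (chi j)) -> is_mxrank A r.
Proof.
move=> /choice[c Ac] Achi; exists (fun i => chi i); split => //.
  move=> v [s vs]; exists (fun j => \sum_(p <- s) p.1 * c p.2 j) => x.
  rewrite vs; under [RHS]eq_bigr do rewrite mulr_suml.
  rewrite exchange_big; apply: eq_bigr => p _; rewrite Ac mulr_sumr.
  by apply: eq_bigr => j _; rewrite mulrA.
move=> b b0 i; have [d dP] := chi_dual.
have := mmap_sum b (fun i => chi i) (d i); rewrite mmapE big1; last first.
  by move=> x _; rewrite b0 mulr0.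
rewrite (bigD1 i) //= dP eqxx mulr1 big1 ?addr0 // => j ji.
by rewrite dP eq_sym (negbTE ji) mulr0.
Qed.

(** * Ranks attached to a combination of characters *)

Section Functional.
Variables (a : 'I_r -> F) (f : X -> F).
Hypothesis a_neq0 : forall i, a i != 0.
Hypothesis fE : forall x, f x = \sum_i a i * chi i x.

Lemma functional_mul x y : f (mmul x y) = \sum_i a i * (chi i x * chi i y).
Proof. by rewrite fE; apply: eq_bigr => i _; rewrite mmorphM. Qed.

Lemma functional_big n (t : n.-tuple X) :
  f (\big[mmul/mone]_(x <- t) x) = \sum_i a i * \prod_j chi i (tnth t j).
Proof.
rewrite fE big_tuple; apply: eq_bigr => i _; congr (_ * _).
by apply: big_morph; [apply: mmorphM | apply: mmorph1].
Qed.

Lemma functional_mxrank : is_mxrank (fun x y => f (mmul x y)) r.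
Proof.
apply: chi_mxrank => [x|j].
  exists (fun i => a i * chi i x) => y; rewrite functional_mul.
  by apply: eq_bigr => i _; rewrite mulrA.
have [d dP] := chi_dual.
(* Row x is the sum of [a i * chi i x] times [chi i], so combining rows with the coefficients of
   [d j] leaves [a j] times [chi j]. *)
exists [seq ((a j)^-1 * (d j)@_x, x) | x <- msupp (d j)] => y.
rewrite big_map; under eq_bigr do rewrite functional_mul mulr_sumr.
rewrite exchange_big.
transitivity (\sum_i (a j)^-1 * (a i * chi i y) * mmap idfun (chi i) (d j)).
  rewrite (bigD1 j) //= dP eqxx mulr1 mulKf // big1 ?addr0 // => i ij.
  by rewrite dP eq_sym (negbTE ij) mulr0.
apply: eq_bigr => i _; rewrite mmapE mulr_sumr; apply: eq_bigr => x _ /=.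
by rewrite [chi i x * _]mulrC [a i * (_ * _)]mulrA mulrACA.
Qed.

(** Extended bilinearly and evaluated on the dual family, the form f(xy) has the invertible matrix
    diag(a), which the decomposition factors through F^s. *)
Lemma functional_factor_ge s (u v : 'I_s -> X -> F) :
  (forall x y, f (mmul x y) = \sum_l u l x * v l y) -> (r <= s)%N.
Proof.
move=> uv; have [d dP] := chi_dual.
pose U := \matrix_(i < r, l < s) mmap idfun (u l) (d i).
pose V := \matrix_(l < s, i < r) mmap idfun (v l) (d i).
have UV : U *m V = diag_mx (\row_i a i).
  apply/matrixP => i j; rewrite !mxE.
  pose B x y := f (mmul x y).
  transitivity (mmap idfun (fun x => mmap idfun (B x) (d j)) (d i)).
    have -> : (fun x => mmap idfun (B x) (d j)) =
        (fun x => \sum_l mmap idfun (v l) (d j) * u l x).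
      apply/funext => x; rewrite (_ : B x = fun y => \sum_l u l x * v l y).
        by rewrite mmap_sum; apply: eq_bigr => l _; rewrite mulrC.
      by apply/funext => y; rewrite /B uv.
    by rewrite mmap_sum; apply: eq_bigr => l _; rewrite !mxE mulrC.
  have -> : (fun x => mmap idfun (B x) (d j)) =
      (fun x => \sum_i a j * (i == j)%:R * chi i x).
    apply/funext => x.
    rewrite (_ : B x = fun y => \sum_l (a l * chi l x) * chi l y); last first.
      by apply/funext => y; rewrite /B functional_mul; under eq_bigr do rewrite mulrA.
    rewrite mmap_sum; apply: eq_bigr => l _; rewrite dP eq_sym.
    by case: eqP => [->|_]; rewrite ?mulr0 ?mulr1 ?mul0r.
  rewrite mmap_sum (bigD1 i) //= big1 ?addr0 => [|l li]; last first.
    by rewrite dP [i == l]eq_sym (negbTE li) mulr0.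
  by rewrite dP eqxx mulr1 mulr_natr; case: eqP => [->|_]; rewrite ?mulr0n.
have Vrk : \rank (U *m V) = r.
  apply: mxrank_unit; rewrite UV unitmxE det_diag unitfE.
  by apply/prodf_neq0 => i _; rewrite mxE.
by rewrite -Vrk (leq_trans (mxrankM_maxl _ _)) // rank_leq_col.
Qed.

Lemma functional_tensor_rank n (T : n.+2.-tuple X -> F) :
  (forall t, T t = f (\big[mmul/mone]_(x <- t) x)) ->
  is_tensor_rank T r.
Proof.
move=> TE; split=> [|s [b [g Tg]]].
  exists a, (fun i _ => chi i) => t; rewrite TE; exact: functional_big.
(* All arguments but the first two are set to [mone]; their constant factors are absorbed into the
   second function. *)
apply: (@functional_factor_ge s (fun l x => b l * g l ord0 x)
  (fun l y => g l (lift ord0 ord0) y *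
     \prod_j g l (lift ord0 (lift ord0 j)) mone)) => x y.
have := Tg [tuple of x :: y :: nseq n mone]; rewrite TE !big_cons.
rewrite big_nseq iter_fix ?mulm1 // => ->; apply: eq_bigr => l _.
rewrite !big_ord_recl /= !mulrA; congr (_ * _); apply: eq_bigr => j _.
by congr (g l _ _); rewrite (tnth_nth mone) /= nth_nseq if_same.
Qed.

Lemma functional_sym_rank n (T : n.+2.-tuple X -> F) :
  (forall t, T t = f (\big[mmul/mone]_(x <- t) x)) -> is_sym_rank T r.
Proof.
move=> TE; split=> [|s [b [g Tg]]].
  by exists a, (fun i => chi i) => t; rewrite TE; apply: functional_big.
by apply: (functional_tensor_rank TE).2; exists b, (fun i _ => g i).
Qed.

End Functional.
End CharacterFamily.

(** * Homomorphism numbers as characters *)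

Section HomCharacters.
Variables (F : fieldType) (dir : bool) (H : wgraph F dir) (k : nat).
Implicit Types phi : {ffun 'I_k -> wvert H}.

Definition extend m phi (eta : {ffun 'I_m -> wvert H}) (v : lvert k m) :=
  match v with inl i => phi i | inr j => eta j end.

Lemma lg_hom_extend phi (G : lgraph k) :
  lg_hom phi G = \sum_(eta : {ffun 'I_(lg_size G) -> wvert H})
    (\prod_j walpha (eta j)) *
    \prod_(e <- lg_edges G) wbeta (extend phi eta e.1) (extend phi eta e.2).
Proof.
rewrite /lg_hom (reindex (fun eta => [ffun v => extend phi eta v])) /=; last first.
  exists (fun psi => [ffun j => psi (inr j)]) => [eta _|psi /forallP psiP].
    by apply/ffunP => j; rewrite !ffunE.
  apply/ffunP => -[i|j]; rewrite !ffunE /= ?ffunE //.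
  by apply/esym/eqP.
apply: eq_big => [eta|eta _]; first by apply/forallP => i; rewrite ffunE.
by congr (_ * _); apply: eq_bigr => e _; rewrite !ffunE.
Qed.

Lemma lg_hom_unit phi : lg_hom phi (lg_unit k) = 1.
Proof.
rewrite lg_hom_extend (big_pred1 (ffun0 (card_ord 0))) => [|eta].
  by rewrite big_ord0 big_nil mulr1.
by apply/esym/eqP/ffunP => -[].
Qed.

(** Once the labeled nodes are fixed by [phi], the unlabeled nodes of the two graphs are mapped
    independently. *)
Lemma lg_hom_glue phi (G1 G2 : lgraph k) :
  lg_hom phi (lg_glue G1 G2) = lg_hom phi G1 * lg_hom phi G2.
Proof.
rewrite !lg_hom_extend /=; set m1 := lg_size G1; set m2 := lg_size G2.
rewrite big_distrlr pair_bigA /=.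
pose join (p : {ffun 'I_m1 -> wvert H} * {ffun 'I_m2 -> wvert H})
    : {ffun 'I_(m1 + m2) -> wvert H} :=
  [ffun j : 'I_(m1 + m2) => match split j with inl x => p.1 x | inr y => p.2 y end].
have joinl p x : join p (lshift m2 x) = p.1 x by rewrite ffunE (unsplitK (inl x)).
have joinr p y : join p (rshift m1 y) = p.2 y by rewrite ffunE (unsplitK (inr y)).
rewrite (reindex join) /=; last first.
  exists (fun eta => ([ffun x => eta (lshift m2 x)], [ffun y => eta (rshift m1 y)])).
    by case=> p q _; congr (_, _); apply/ffunP => x; rewrite ffunE ?joinl ?joinr.
  move=> eta _; apply/ffunP => j; rewrite -(splitK j).
  by case: (split j) => x /=; rewrite ?joinl ?joinr ffunE.
apply: eq_bigr => p _; rewrite big_split_ord /= lg_glueE /glue_edges big_cat !big_map /=.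
rewrite mulrACA; congr (_ * _ * (_ * _)); apply: eq_bigr => e _; rewrite ?joinl ?joinr //.
  by case: e => -[?|?] [?|?] /=; rewrite ?joinl.
by case: e => -[?|?] [?|?] /=; rewrite ?joinr.
Qed.

Lemma hom_phi_mmorphism phi : mmorphism (@hom_phi F dir H k phi).
Proof.
split=> [x y|].
  by rewrite -[x]reprK -[y]reprK [mmul _ _]pi_glue !hom_phi_pi; apply: lg_hom_glue.
by rewrite [mone](_ : _ = \pi_(PLG dir k) (lg_unit k)) // hom_phi_pi lg_hom_unit.
Qed.
HB.instance Definition _ phi :=
  isMultiplicative.Build (PLG dir k) F (@hom_phi F dir H k phi)
    (hom_phi_mmorphism phi).

Lemma hom_sum_phi (G : PLG dir k) :
  hom H G = \sum_(phi : {ffun 'I_k -> wvert H})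
    (\prod_i walpha (phi i)) * hom_phi phi G.
Proof.
rewrite /hom /hom_phi; move: (repr G) => {}G; rewrite /lg_homT /lg_hom.
rewrite (partition_big (fun psi : {ffun _ -> _} => [ffun i => psi (inl i)]) predT) //=.
apply: eq_bigr => phi _; rewrite mulr_sumr; apply: eq_big => [psi|psi].
  apply/eqP/forallP => [<- i|psiP]; first by rewrite ffunE.
  by apply/ffunP => i; rewrite ffunE; apply/eqP.
move=> /eqP <-; rewrite big_sumType /= mulrA; congr (_ * _ * _).
by apply: eq_bigr => i _; rewrite ffunE.
Qed.

Lemma hom_phi_aut phi s (G : PLG dir k) :
  s \in waut H -> hom_phi (map_act phi s) G = hom_phi phi G.
Proof.
move=> /wautP[sa sb]; rewrite /hom_phi; move: (repr G) => {}G.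
rewrite !lg_hom_extend.
rewrite (reindex (fun eta : {ffun _ -> wvert H} => [ffun j => s (eta j)])) /=.
  apply: eq_bigr => eta _; congr (_ * _).
    by apply: eq_bigr => j _; rewrite ffunE sa.
  apply: eq_bigr => -[u v] _ /=; rewrite -[RHS]sb.
  by case: u => u; case: v => v; rewrite /= ?ffunE.
exists (fun eta : {ffun _ -> wvert H} => [ffun j => (s^-1)%g (eta j)]) => eta _;
  by apply/ffunP => j; rewrite !ffunE ?permK ?permKV.
Qed.

(* The predicate depends on phi only through hom_phi, and so does the pick.  *)
Definition hom_rep phi : {ffun 'I_k -> wvert H} :=
  odflt phi [pick psi | `[< @hom_phi F dir H k psi = hom_phi phi >]].

Lemma hom_repE phi : @hom_phi F dir H k (hom_rep phi) = hom_phi phi.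
Proof. by rewrite /hom_rep; case: pickP => //= psi /asboolP. Qed.

Lemma hom_rep_eq phi psi : @hom_phi F dir H k phi = hom_phi psi ->
  hom_rep phi = hom_rep psi.
Proof.
move=> e; rewrite /hom_rep e; case: pickP => //= /(_ psi).
by move/asboolP; case.
Qed.

Definition hom_reps := [set phi | hom_rep phi == phi].

(** The coefficient in f_H of a whole class of equal [hom_phi]; it can vanish by cancellation, and
    then the class counts for N but not for M. *)
Definition hom_coef phi : F :=
  \sum_(psi : {ffun 'I_k -> wvert H} | hom_rep psi == phi) \prod_i walpha (psi i).

Definition hom_supp := [set phi in hom_reps | hom_coef phi != 0].

Lemma hom_rep_in phi : hom_rep phi \in hom_reps.
Proof. by rewrite inE; apply/eqP/hom_rep_eq/hom_repE. Qed.

Lemma hom_sum_supp (G : PLG dir k) :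
  hom H G = \sum_(phi in hom_supp) hom_coef phi * hom_phi phi G.
Proof.
rewrite hom_sum_phi (partition_big hom_rep (mem hom_reps)) /=; last first.
  by move=> phi _; apply: hom_rep_in.
transitivity (\sum_(phi in hom_reps) hom_coef phi * hom_phi phi G).
  apply: eq_bigr => phi _; rewrite /hom_coef mulr_suml.
  by apply: eq_bigr => psi /eqP <-; rewrite hom_repE.
rewrite (bigID (fun phi => hom_coef phi != 0)) /= addrC big1 ?add0r => [|phi].
  by apply: eq_bigl => phi; rewrite [RHS]inE.
by move=> /andP[_ /negPn/eqP->]; rewrite mul0r.
Qed.

Lemma card_hom_reps : (#|hom_reps| <= orb_num H k)%N.
Proof.
rewrite /orb_num -(card_in_imset (f := orbit (map_action H k) (waut H)) (D := hom_reps)).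
  by apply: subset_leq_card; apply: imsetS; apply: subsetT.
(* Representatives in one orbit have the same [hom_phi], hence coincide. *)
move=> phi psi; rewrite !inE => /eqP {2}<- /eqP {2}<- /orbit_eqP.
move=> /orbitP[s sH <-]; apply: hom_rep_eq; apply/funext => G.
exact: hom_phi_aut.
Qed.

Lemma hom_rep_inj_on (A : {set {ffun 'I_k -> wvert H}}) : A \subset hom_reps ->
  forall i j : 'I_#|A|,
    hom_phi (enum_val i) =1 @hom_phi F dir H k (enum_val j) -> i = j.
Proof.
move=> /subsetP sA i j /funext e; apply: enum_val_inj.
have := sA _ (enum_valP i); have := sA _ (enum_valP j); rewrite !inE.
by move=> /eqP <- /eqP <-; apply: hom_rep_eq.
Qed.

Lemma hom_matrix_rank : is_mxrank (hom_matrix H k) #|hom_reps|.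
Proof.
apply: (chi_mxrank (chi := fun i => @hom_phi F dir H k (enum_val i))).
- exact: hom_rep_inj_on.
- move=> phi; exists (fun j => (j == enum_rank_in (hom_rep_in phi) (hom_rep phi))%:R) => x.
  rewrite (bigD1 (enum_rank_in (hom_rep_in phi) (hom_rep phi))) //= eqxx mul1r.
  rewrite enum_rankK_in ?hom_rep_in // hom_repE big1 ?addr0 // => j /negbTE->.
  by rewrite mul0r.
- by move=> j; exists [:: (1, enum_val j)] => x; rewrite big_seq1 mul1r.
Qed.

(** * The quotient algebra and its dimension *)

Section Quotient.
Variables (r : nat) (chi : 'I_r -> {mmorphism PLG dir k -> F}) (a : 'I_r -> F).
Hypothesis chi_inj : forall i j, chi i =1 chi j -> i = j.
Hypothesis a_neq0 : forall i, a i != 0.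
Hypothesis homE : forall G, hom H G = \sum_i a i * chi i G.

(** Testing x against [d i] gives [a i] times the value of [chi i] at x, and [a i] is nonzero. *)
Lemma homK_chi (x : {malg F[PLG dir k]}) :
  x \in @homK F dir H k <-> forall i, mmap idfun (chi i) x = 0.
Proof.
have LE z : homL H z = \sum_i a i * mmap idfun (chi i) z.
  by rewrite /homL (_ : hom H = fun G => \sum_i a i * chi i G) ?mmap_sum //; apply/funext.
split=> [/homKP x0 i|x0]; last first.
  by apply/homKP => y; rewrite LE big1 // => i _; rewrite rmorphM /= x0 mul0r mulr0.
have [d dP] := chi_dual chi_inj; have := x0 (d i); rewrite LE (bigD1 i) //=.
rewrite rmorphM /= dP eqxx mulr1 big1 ?addr0 => [/eqP|j ji].
  by rewrite mulf_eq0 (negbTE (a_neq0 i)) => /eqP.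
by rewrite rmorphM /= dP eq_sym (negbTE ji) !mulr0.
Qed.

Definition qalg_ev (x : qalg H k) : {ffun 'I_r -> F^o} :=
  [ffun i => mmap idfun (chi i) (repr x)].

Lemma qalg_ev_pi x : qalg_ev (\pi_(qalg H k) x) = [ffun i => mmap idfun (chi i) x].
Proof.
apply/ffunP => i; rewrite !ffunE; apply/eqP; rewrite -subr_eq0 -raddfB; apply/eqP.
by have /homK_chi := @qrepr F dir H k x; apply.
Qed.

Lemma qalg_isoP : qalg_iso H k r.
Proof.
have [d dP] := chi_dual chi_inj.
have dsum := mmap_dual_sum dP.
exists qalg_ev; split.
(* The inverse interpolates the prescribed values by the dual family. *)
- exists (fun v : {ffun 'I_r -> F^o} => \pi_(qalg H k) (\sum_i v i *: d i)) => [x|v].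
    rewrite -[RHS]reprK; apply/qalg_eqP/homK_chi => i.
    by rewrite raddfB /= dsum ffunE subrr.
  by rewrite qalg_ev_pi; apply/ffunP => i; rewrite ffunE dsum.
- move=> c x y; rewrite -[x]reprK -[y]reprK; move: (repr x) (repr y) => {}x {}y.
  rewrite [c *: _]qpiZ -qpiD !qalg_ev_pi; apply/ffunP => i.
  by rewrite !ffunE raddfD /= mmapZ.
- split=> [|x y]; first by rewrite [1]/(qone H k) qalg_ev_pi;
    apply/ffunP => i; rewrite !ffunE mmap1.
  rewrite -[x]reprK -[y]reprK; move: (repr x) (repr y) => {}x {}y.
  rewrite [_ * _]qpiM !qalg_ev_pi; apply/ffunP => i.
  by rewrite !ffunE rmorphM.
Qed.

End Quotient.
End HomCharacters.

Lemma qalg_iso_dim (F : fieldType) (dir : bool) (H : wgraph F dir) k r :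
  qalg_iso H k r -> is_dim (qalg H k) r.
Proof.
move=> [f [[g fK gK] flin _]].
pose fL_mixin := GRing.isLinear.Build F (qalg H k) {ffun 'I_r -> F^o} *:%R f flin.
pose fL : {linear qalg H k -> {ffun 'I_r -> F^o}} := HB.pack f fL_mixin.
have fZ c x : f (c *: x) = c *: f x by apply: (linearZZ fL).
have fsum (c : 'I_r -> F) i :
    f (\sum_j c j *: g [ffun l => (j == l)%:R]) i = c i.
  rewrite [f _](linear_sum fL) sum_ffunE (bigD1 i) //= big1 => [|j ji].
    by rewrite addr0 fZ ffunE gK ffunE eqxx; apply: mulr1.
  by rewrite fZ ffunE gK ffunE (negbTE ji); apply: mulr0.
exists (fun i => g [ffun j => (i == j)%:R]); split=> [v|c c0 i].
  by exists (f v); apply: (can_inj fK); apply/ffunP => i; rewrite fsum.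
by rewrite -(fsum c i) c0 [f 0](linear0 fL) ffunE.
Qed.

Theorem theorem8p3 (F : fieldType) (dir : bool) (H : wgraph F dir)
    (Htf : twin_free H) (k n : nat) (Hn : (2 <= n)%N) :
  exists r s : nat,
    qalg_iso H k r /\
    is_dim (qalg H k) r /\
    is_sym_rank (conn_tensor H k n) r /\
    is_tensor_rank (conn_tensor H k n) r /\
    is_mxrank (conn_matrix H k) r /\
    is_mxrank (hom_matrix H k) s /\
    (r <= s)%N /\ (s <= orb_num H k)%N.
Proof.
case: n Hn => [|[|n]] // _.
pose chi i : {mmorphism PLG dir k -> F} :=
  @hom_phi F dir H k (@enum_val _ (mem (hom_supp H k)) i).
pose a i := hom_coef (@enum_val _ (mem (hom_supp H k)) i).
have sub : hom_supp H k \subset hom_reps H k by apply/subsetP => phi /setIdP[].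
have chi_inj i j : chi i =1 chi j -> i = j by apply: hom_rep_inj_on.
have a_neq0 i : a i != 0 by have /setIdP[] := enum_valP i.
have homE G : hom H G = \sum_i a i * chi i G by rewrite hom_sum_supp big_enum_val.
have iso := qalg_isoP chi_inj a_neq0 homE.
exists #|hom_supp H k|, #|hom_reps H k|; split=> //; split; first exact: qalg_iso_dim.
split; first exact: (functional_sym_rank chi_inj a_neq0 homE).
split; first exact: (functional_tensor_rank chi_inj a_neq0 homE).
split.
  have -> : conn_matrix H k = fun x y => hom H (mmul x y).
    apply/funext => x; apply/funext => y.
    by rewrite /conn_matrix /conn_tensor !big_cons big_nil mulm1.
  exact: (functional_mxrank chi_inj a_neq0 homE).
split; first exact: hom_matrix_rank.
by split; [apply: subset_leq_card | apply: card_hom_reps].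
Qed.
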